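(* Let $k$ be a field of characteristic zero. The conjugacy classes of $\mathrm{BAs}_3(k)$ in $\mathrm{BA}_3(k)$ are those of (1) $(x_1,x_2,x_3)$; (2) $(x_1,x_2,x_3+1)$; (3) $(x_1+f_1(x_2,x_3),\,x_2+f_2(x_3),\,x_3)$, where $f_2(x_3)=c_mx_3^m+c_{m-2}x_3^{m-2}+\cdots+c_0\in k[x_3]$ with $c_m\neq0$ (the next-to-highest coefficient is zero), and additionally $f_2$ is a unique element in its orbit under the action $\lambda\mapsto\lambda^{-1}f_2(\lambda x_3)$ of $k^*$; moreover $$f_1(x_2,x_3)=a_n(x_3)x_2^n+a_{n-1}(x_3)x_2^{n-1}+\cdots+a_0(x_3),$$ where for $i=0,1,\ldots,n-2,n$ the polynomial $a_i(x_3)$ is the lowest degree element in $a_i(x_3)+f_2(x_3)k[x_3]$, while $a_{n-1}(x_3)$ is the lowest degree element in $a_{n-1}(x_3)+(f_2(x_3),a_n(x_3))k[x_3]$; furthermore, the sequence $(a_n,a_{n-1},\ldots,a_0)$ is picked uniquely from its orbit under conjugation by the maps $(x_1,x_2,\lambda x_3)$, $\lambda\in k^*$.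
   Context: $\mathrm{BA}_3(k)$ is the group (under composition) of triangular polynomial automorphisms $(a_1x_1+f_1,a_2x_2+f_2,a_3x_3+f_3)$ with $a_i\in k^*$, $f_1\in k[x_2,x_3]$, $f_2\in k[x_3]$, $f_3\in k$; $\mathrm{BAs}_3(k)$ is its subgroup of strictly triangular maps, those with $a_1=a_2=a_3=1$. The conjugacy classes of $\mathrm{BAs}_3(k)$ in $\mathrm{BA}_3(k)$ are the classes of elements of $\mathrm{BAs}_3(k)$ under the relation $G=HFH^{-1}$ for some $H\in\mathrm{BA}_3(k)$. The lowest degree element of a coset of an ideal of $k[x_3]$ is $0$ if the coset is the ideal itself. ''A unique element in its orbit'' / ''picked uniquely from its orbit'' means that a system of representatives of the orbits is fixed once and for all and the element is required to lie in it.
   Formalization: In (3), f_2 = 0 is also allowed (otherwise the class of (x_1+x_2, x_2, x_3) is missed), and the orbit of (a_n,…,a_0) is taken with f_2 held fixed, i.e. only over λ with f_2(λx_3) = f_2(x_3), since using all λ makes the claim fail for some representatives. *)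

(* Defs.v *)
From HB Require Import structures.
From mathcomp Require Import all_boot all_order all_algebra.
From mathcomp Require Import mpoly.

Set Implicit Arguments.
Unset Strict Implicit.
Unset Printing Implicit Defensive.

Import GRing.Theory.
Local Open Scope ring_scope.

Section Maps.
Variable k : fieldType.

Definition polymap := (3.-tuple {mpoly k[3]})%type.

(* (pcomp F G) is F after G: substitute the components of G into those of F. *)
Definition pcomp (F G : polymap) : polymap :=
  [tuple comp_mpoly G (tnth F i) | i < 3].

Definition pid : polymap := [tuple 'X_i | i < 3].

Definition inverse_maps (H K : polymap) : Prop :=
  pcomp H K = pid /\ pcomp K H = pid.

Definition x1 : {mpoly k[3]} := 'X_(@Ordinal 3 0 isT).
Definition x2 : {mpoly k[3]} := 'X_(@Ordinal 3 1 isT).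
Definition x3 : {mpoly k[3]} := 'X_(@Ordinal 3 2 isT).

(* k[x3] is {poly k}, and k[x2,x3] = k[x3][x2] is {poly {poly k}}: the
   coefficient f`_i of f : {poly {poly k}} is the factor a_i(x3) of x2^i. *)
Definition in_x3 (f : {poly k}) : {mpoly k[3]} :=
  (map_poly (@mpolyC 3 k) f).[x3].
Definition in_x2x3 (f : {poly {poly k}}) : {mpoly k[3]} :=
  (map_poly in_x3 f).[x2].

Definition triangular (a1 a2 a3 : k)
    (f1 : {poly {poly k}}) (f2 : {poly k}) (f3 : k) : polymap :=
  [tuple a1 *: x1 + in_x2x3 f1; a2 *: x2 + in_x3 f2; a3 *: x3 + mpolyC 3 f3].

Definition strictly_triangular := triangular 1 1 1.

Definition BA3 (F : polymap) : Prop :=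
  exists a1 a2 a3 f1 f2 f3,
    [/\ a1 != 0, a2 != 0, a3 != 0 & F = triangular a1 a2 a3 f1 f2 f3].

Definition BAs3 (F : polymap) : Prop :=
  exists f1 f2 f3, F = strictly_triangular f1 f2 f3.

Definition conjugate_by (H F G : polymap) : Prop :=
  exists2 K, inverse_maps H K & G = pcomp (pcomp H F) K.

Definition BA3_conjugate (F G : polymap) : Prop :=
  exists2 H, BA3 H & conjugate_by H F G.

Definition conj_class (F : polymap) : polymap -> Prop :=
  fun G => BAs3 G /\ BA3_conjugate F G.

Definition is_conj_class (C : polymap -> Prop) : Prop :=
  exists2 F, BAs3 F & forall G, C G <-> conj_class F G.

(* One chosen point, and only one, in each orbit. *)
Definition representatives (T : Type) (orbit : T -> T -> Prop)
    (P : T -> Prop) : Prop :=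
  forall x, exists! y, orbit x y /\ P y.

Definition scaling_orbit (f g : {poly k}) : Prop :=
  exists2 lam : k, lam != 0 & g = lam^-1 *: (f \Po (lam *: 'X)).

(* Conjugation acts on maps, so the orbit of the sequence of coefficients of
   f1 is taken among the maps with the given second component x2 + f2. *)
Definition sequence_orbit (f2 : {poly k}) (f1 g1 : {poly {poly k}}) : Prop :=
  exists2 lam : k, lam != 0 &
    conjugate_by (triangular 1 1 lam 0 0 0)
      (strictly_triangular f1 f2 0) (strictly_triangular g1 f2 0).

(* The ideal (g, h) of k[x3]; (g, 0) is the principal ideal g k[x3]. *)
Definition ideal2 (g h p : {poly k}) : Prop :=
  exists u v, p = u * g + v * h.

(* As size 0 = 0, this forces a = 0 when a lies in the ideal. *)
Definition lowest_degree_in_coset (I : {poly k} -> Prop) (a : {poly k}) : Prop :=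
  forall b, I (b - a) -> (size a <= size b)%N.

(* f2 = c_m x3^m + c_{m-2} x3^{m-2} + ... + c_0, with c_m = lead_coef f2; a
   constant has no next-to-highest coefficient.  The zero polynomial is
   included: the maps (x1 + f1, x2, x3) are conjugate to none with f2 != 0. *)
Definition next_to_highest_zero (f2 : {poly k}) : Prop :=
  (1 < size f2)%N -> f2`_(size f2).-2 = 0.

(* n = (size f1).-1 is the degree of f1 in x2; f1 = 0 is the case n = 0,
   a_0 = 0. *)
Definition reduced_coefficients (f2 : {poly k}) (f1 : {poly {poly k}}) : Prop :=
  let n := (size f1).-1 in
  (forall i, (i <= n)%N -> i.+1 <> n ->
     lowest_degree_in_coset (ideal2 f2 0) f1`_i) /\
  ((0 < n)%N -> lowest_degree_in_coset (ideal2 f2 f1`_n) f1`_n.-1).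

Variables (P2 : {poly k} -> Prop) (P1 : {poly k} -> {poly {poly k}} -> Prop).

Definition normal_form (F : polymap) : Prop :=
  [\/ F = [tuple x1; x2; x3],
      F = [tuple x1; x2; x3 + 1]
    | exists f1 f2,
        [/\ F = [tuple x1 + in_x2x3 f1; x2 + in_x3 f2; x3],
            next_to_highest_zero f2,
            P2 f2,
            reduced_coefficients f2 f1
          & P1 f2 f1]].

End Maps.

(* Main.v *)
(** Triangular maps are closed under composition, and a right inverse is found
    by solving from the third component upwards, so BA_3 is a group and it
    suffices to move every F = (x1 + f1, x2 + f2, x3 + c) to a normal form by
    successive conjugations.
    If c <> 0, then v |-> v o F - v is surjective on k[x3] and on k[x2,x3]: on
    k[x3] it sends u x3^(i+1) to (i+1) c u x3^i plus lower terms, and on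
    k[x2,x3] it sends u x2^n to (u(x3 + c) - u) x2^n plus lower terms. Hence F
    is conjugate to (x1, x2, x3 + 1).
    If c = 0, a translation of x3 kills the next-to-highest coefficient of f2
    and a scaling of (x2, x3) puts f2 in its set of representatives.
    Conjugation by (x1 + g, x2, x3) adds g(x2 + f2, x3) - g(x2, x3) to f1, and
    g = u x2^(i+1) / (i+1) changes the coefficients of f1 in degrees >= i only
    by adding u f2 to a_i; conjugation by (x1, x2 + h(x3), x3) changes a_{n-1}
    by n h a_n. So one reduces from the top coefficient down, and a last
    scaling of x3, which preserves reducedness, picks the representative of
    f1. *)
Require Import Defs.
From HB Require Import structures.
From mathcomp Require Import all_boot all_order all_algebra.
From mathcomp Require Import mpoly.

Set Implicit Arguments.
Unset Strict Implicit.
Unset Printing Implicit Defensive.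

Import GRing.Theory.
Local Open Scope ring_scope.

HB.instance Definition _ (k : fieldType) :=
  GRing.RMorphism.copy (@in_x3 k)
    (horner_eval (x3 k) \o map_poly (@mpolyC 3 k)).

HB.instance Definition _ (k : fieldType) :=
  GRing.RMorphism.copy (@in_x2x3 k)
    (horner_eval (x2 k) \o map_poly (@in_x3 k)).

(* [pcomp] alone now denotes the composition of partial functions of ssrfun. *)
Local Notation "F \c G" := (Defs.pcomp F G) (at level 40, left associativity).

(** * Polynomial rings, substitutions and composition of triangular maps *)

Section Maps.
Variable k : fieldType.
Implicit Types (a b c lam : k) (f g h u v : {poly k}) (p q r : {poly {poly k}}).
Implicit Types F G H K : polymap k.

Lemma in_x3C c : in_x3 c%:P = mpolyC 3 c.
Proof. by rewrite /in_x3 map_polyC hornerC. Qed.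

Lemma in_x3X : in_x3 'X = x3 k.
Proof. by rewrite /in_x3 map_polyX hornerX. Qed.

Lemma in_x2x3C f : in_x2x3 f%:P = in_x3 f.
Proof. by rewrite /in_x2x3 map_polyC hornerC. Qed.

Lemma in_x2x3X : in_x2x3 'X = x2 k.
Proof. by rewrite /in_x2x3 map_polyX hornerX. Qed.

Lemma in_x3Z a f : in_x3 (a *: f) = a *: in_x3 f.
Proof. by rewrite -mul_polyC rmorphM /= in_x3C mul_mpolyC. Qed.

Lemma in_x2x3Z a p : in_x2x3 (a%:P *: p) = a *: in_x2x3 p.
Proof. by rewrite -mul_polyC rmorphM /= in_x2x3C in_x3C mul_mpolyC. Qed.

(** Evaluation at x1 = 0, with x2 the outer and x3 the inner variable, is a left inverse. *)
Lemma in_x2x3_inj : injective (@in_x2x3 k).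
Proof.
pose h := tnth [tuple 0; 'X; ('X : {poly k})%:P].
pose ev : {rmorphism {mpoly k[3]} -> {poly {poly k}}} :=
  mmap (polyC \o @polyC k) h.
have evX i : ev 'X_i = h i by rewrite [LHS]mmapX mmap1U.
have ev3 f : ev (in_x3 f) = f%:P.
  rewrite /in_x3 -(horner_map ev) -map_poly_comp /x3 evX.
  rewrite (eq_map_poly (g := polyC \o @polyC k)); last first.
    by move=> c; exact: mmapC.
  rewrite map_poly_comp horner_map /=. congr _%:P; exact: comp_polyXr.
apply: (can_inj (g := ev)) => p.
rewrite /in_x2x3 -(horner_map ev) -map_poly_comp /x2 evX.
rewrite (eq_map_poly (g := polyC)) //; exact: comp_polyXr.
Qed.

Lemma in_x3_inj : injective (@in_x3 k).
Proof.
by move=> f g; rewrite -!in_x2x3C => /in_x2x3_inj /polyC_inj.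
Qed.

(** The endomorphism of k[x3][x2] sending x3 to [w3] and x2 to [w2]. Coefficients are substituted
    first, so [w3] does not act on [w2]. *)
Definition subst_x2x3 (w3 : {poly k}) (w2 p : {poly {poly k}}) :=
  map_poly (comp_poly w3) p \Po w2.

HB.instance Definition _ w3 w2 :=
  GRing.RMorphism.copy (subst_x2x3 w3 w2)
    (comp_poly w2 \o map_poly (comp_poly w3)).

Lemma comp_in_x3 G w f :
  tnth G (@Ordinal 3 2 isT) = in_x3 w ->
  comp_mpoly G (in_x3 f) = in_x3 (f \Po w).
Proof.
move=> Gw; rewrite /in_x3 -(horner_map (comp_mpoly G)) -map_poly_comp /=.
have -> : comp_mpoly G (x3 k) = in_x3 w by rewrite comp_mpolyXU -tnth_nth.
rewrite (eq_map_poly (g := @mpolyC 3 k)) => [|c]; last exact: comp_mpolyC.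
rewrite -/(in_x3 _) /comp_poly -(horner_map (@in_x3 k)) -map_poly_comp.
by congr _.[_]; apply: eq_map_poly => c /=; rewrite in_x3C.
Qed.

Lemma comp_in_x2x3 G w3 w2 p :
  tnth G (@Ordinal 3 2 isT) = in_x3 w3 ->
  tnth G (@Ordinal 3 1 isT) = in_x2x3 w2 ->
  comp_mpoly G (in_x2x3 p) = in_x2x3 (subst_x2x3 w3 w2 p).
Proof.
move=> Gw3 Gw2; rewrite [in LHS]/in_x2x3 -(horner_map (comp_mpoly G)) /=.
have -> : comp_mpoly G (x2 k) = in_x2x3 w2 by rewrite comp_mpolyXU -tnth_nth.
rewrite /subst_x2x3 /comp_poly -(horner_map (@in_x2x3 k)) -!map_poly_comp.
congr _.[_]; apply: eq_map_poly => f /=.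
by rewrite in_x2x3C (comp_in_x3 _ Gw3).
Qed.

Lemma polymapP F G :
  tnth F (@Ordinal 3 0 isT) = tnth G (@Ordinal 3 0 isT) ->
  tnth F (@Ordinal 3 1 isT) = tnth G (@Ordinal 3 1 isT) ->
  tnth F (@Ordinal 3 2 isT) = tnth G (@Ordinal 3 2 isT) -> F = G.
Proof.
move=> e0 e1 e2; apply: eq_from_tnth => -[[|[|[|i]]] Hi] //.
- by rewrite (bool_irrelevance Hi isT).
- by rewrite (bool_irrelevance Hi isT).
- by rewrite (bool_irrelevance Hi isT).
Qed.

Lemma tnth_triangular a1 a2 a3 p f c :
  let F := triangular a1 a2 a3 p f c in
  (tnth F (@Ordinal 3 0 isT) = a1 *: x1 k + in_x2x3 p) *
  (tnth F (@Ordinal 3 1 isT) = a2 *: x2 k + in_x3 f) *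
  (tnth F (@Ordinal 3 2 isT) = a3 *: x3 k + mpolyC 3 c).
Proof. by []. Qed.

(** Turns composition into substitution in [{poly _}], where conjugations can be checked parameter
    by parameter. *)
Lemma pcomp_triangular a1 a2 a3 p f c b1 b2 b3 q g d :
  triangular a1 a2 a3 p f c \c triangular b1 b2 b3 q g d =
  triangular (a1 * b1) (a2 * b2) (a3 * b3)
    (a1%:P *: q + subst_x2x3 (b3 *: 'X + d%:P) (b2%:P *: 'X + g%:P) p)
    (a2 *: g + (f \Po (b3 *: 'X + d%:P))) (a3 * d + c).
Proof.
set G := triangular b1 b2 b3 q g d.
have G2 : tnth G (@Ordinal 3 2 isT) = in_x3 (b3 *: 'X + d%:P).
  by rewrite rmorphD /= in_x3Z in_x3X in_x3C.
have G1 : tnth G (@Ordinal 3 1 isT) = in_x2x3 (b2%:P *: 'X + g%:P).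
  by rewrite rmorphD /= in_x2x3Z in_x2x3X in_x2x3C.
apply: polymapP; rewrite tnth_mktuple !tnth_triangular comp_mpolyD comp_mpolyZ.
- rewrite (comp_in_x2x3 _ G2 G1) comp_mpolyXU -tnth_nth tnth_triangular.
  by rewrite rmorphD /= in_x2x3Z scalerDr scalerA addrA.
- rewrite (comp_in_x3 _ G2) comp_mpolyXU -tnth_nth tnth_triangular.
  by rewrite rmorphD /= in_x3Z scalerDr scalerA addrA.
- rewrite comp_mpolyC comp_mpolyXU -tnth_nth tnth_triangular mpolyCD mpolyCM.
  by rewrite scalerDr scalerA -addrA -(mul_mpolyC a3).
Qed.


(** * Group structure and conjugacy *)

Lemma pcompA F G H : F \c (G \c H) = F \c G \c H.
Proof.
apply: eq_from_tnth => i; rewrite !tnth_mktuple.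
rewrite (comp_mpolyEX _ G) raddf_sum (comp_mpolyEX _ (G \c H)) /=.
apply: eq_bigr => m _; rewrite comp_mpolyZ; congr (_ *: _).
rewrite !comp_mpolyX rmorph_prod /=; apply: eq_bigr => j _.
by rewrite rmorphXn tnth_mktuple.
Qed.

Lemma pcompr1 F : F \c pid k = F.
Proof. by apply: eq_from_tnth => i; rewrite tnth_mktuple comp_mpoly_id. Qed.

Lemma pcompl1 F : pid k \c F = F.
Proof.
apply: eq_from_tnth => i.
by rewrite !tnth_mktuple comp_mpolyXU -tnth_nth.
Qed.

Lemma subst_x2x3_id p : subst_x2x3 'X 'X p = p.
Proof.
by rewrite /subst_x2x3 comp_polyXr map_poly_id // => f _; rewrite comp_polyXr.
Qed.

Lemma triangular_id : triangular 1 1 1 0 0 0 = pid k.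
Proof.
by apply: polymapP;
  rewrite tnth_mktuple tnth_triangular ?rmorph0 ?addr0 ?scale1r.
Qed.

Lemma BA3_comp F G : BA3 F -> BA3 G -> BA3 (F \c G).
Proof.
move=> [a1 [a2 [a3 [p [f [c [Ha1 Ha2 Ha3 ->]]]]]]].
move=> [b1 [b2 [b3 [q [g [d [Hb1 Hb2 Hb3 ->]]]]]]].
rewrite pcomp_triangular; do 6![eexists]; split; last reflexivity.
all: by rewrite mulf_neq0.
Qed.

Lemma BA3_right_inverse F : BA3 F -> exists2 G, BA3 G & F \c G = pid k.
Proof.
move=> [a1 [a2 [a3 [p [f [c [Ha1 Ha2 Ha3 ->]]]]]]].
(* [w3] and [w2] are the third and second components of the inverse. *)
pose w3 := a3^-1 *: 'X + (- (a3^-1 * c))%:P.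
pose g := - (a2^-1 *: (f \Po w3)).
pose w2 := a2^-1%:P *: 'X + g%:P.
exists (triangular a1^-1 a2^-1 a3^-1 (- (a1^-1%:P *: subst_x2x3 w3 w2 p)) g
          (- (a3^-1 * c))).
  by do 6![eexists]; split; last reflexivity; rewrite invr_neq0.
rewrite pcomp_triangular -/w3 -/w2 -triangular_id !divff //.
rewrite !scalerN scalerA -polyCM divff // scale1r addNr.
by rewrite scalerA divff // scale1r addNr mulrN mulrA divff // mul1r addNr.
Qed.

(* A monoid in which every element has a right inverse is a group. *)
Lemma BA3_inverse F : BA3 F -> exists2 G, BA3 G & inverse_maps F G.
Proof.
move=> /BA3_right_inverse [G BG FG]; exists G => //; split=> //.
have [H _ GH] := BA3_right_inverse BG.
by rewrite -[F in G \c F]pcompr1 -GH (pcompA F) FG pcompl1.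
Qed.

(** The intertwining equation avoids the inverse of [H], which the group structure supplies. *)
Lemma BA3_conjugateP F G :
  BA3_conjugate F G <-> exists2 H, BA3 H & G \c H = H \c F.
Proof.
split=> [[H BH [K [HK KH] ->]]|[H BH GH]]; exists H => //.
  by rewrite -pcompA KH pcompr1.
have [K _ HK] := BA3_inverse BH; exists K => //.
by rewrite -GH -pcompA HK.1 pcompr1.
Qed.

Lemma BA3_conjugate_trans F G H :
  BA3_conjugate F G -> BA3_conjugate G H -> BA3_conjugate F H.
Proof.
move=> /BA3_conjugateP [A BA eA] /BA3_conjugateP [B BB eB].
apply/BA3_conjugateP; exists (B \c A); first exact: BA3_comp.
by rewrite pcompA eB -pcompA eA pcompA.
Qed.

Lemma BA3_conjugate_sym F G : BA3_conjugate F G -> BA3_conjugate G F.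
Proof.
move=> /BA3_conjugateP [A BA eA]; have [B BB [AB BA1]] := BA3_inverse BA.
apply/BA3_conjugateP; exists B => //.
by rewrite -[F]pcompl1 -BA1 -(pcompA B) -eA -!pcompA AB pcompr1.
Qed.

Lemma BA3_conjugate_conj_class F G :
  BA3_conjugate F G -> forall H, conj_class F H <-> conj_class G H.
Proof.
move=> FG H; split=> -[BH cH]; split=> //.
  exact: BA3_conjugate_trans (BA3_conjugate_sym FG) cH.
exact: BA3_conjugate_trans cH.
Qed.

Lemma conjugate_intertwine a1 a2 a3 p f c F G :
  a1 != 0 -> a2 != 0 -> a3 != 0 ->
  G \c triangular a1 a2 a3 p f c = triangular a1 a2 a3 p f c \c F ->
  BA3_conjugate F G.
Proof.
move=> Ha1 Ha2 Ha3 GF; apply/BA3_conjugateP.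
exists (triangular a1 a2 a3 p f c) => //.
by exists a1, a2, a3, p, f, c; split.
Qed.

(** The conjugator is (x1 + q, x2 + g, c^-1 x3): the scaling turns [c] into 1, and the two equations
    clear the other components. *)
Lemma conjugate_translation p f c q g :
  c != 0 ->
  q - subst_x2x3 ('X + c%:P) ('X + f%:P) q = p ->
  g - (g \Po ('X + c%:P)) = f ->
  BA3_conjugate (strictly_triangular p f c) (strictly_triangular 0 0 1).
Proof.
move=> c0 qp gf.
have i0 : c^-1 != 0 by rewrite invr_neq0.
apply: (conjugate_intertwine (p := q) (f := g) (c := 0) (oner_neq0 _)
  (oner_neq0 _) i0).
rewrite !pcomp_triangular !(mulr1, mul1r, scale1r, addr0, add0r, mulVf c0) //.
rewrite rmorph0 comp_poly0 !addr0; congr triangular.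
  by rewrite -qp subrK.
by rewrite -gf subrK.
Qed.

Lemma conjugate_add_coboundary p f q :
  BA3_conjugate (strictly_triangular p f 0)
    (strictly_triangular (p + ((q \Po ('X + f%:P)) - q)) f 0).
Proof.
apply: (conjugate_intertwine (p := q) (f := 0) (c := 0) (oner_neq0 _)
  (oner_neq0 _) (oner_neq0 _)).
rewrite !pcomp_triangular !(mulr1, mul1r, scale1r, addr0, add0r).
rewrite subst_x2x3_id comp_polyXr comp_poly0 addr0; congr triangular.
rewrite /subst_x2x3 map_poly_id => [|h _]; last by rewrite comp_polyXr.
by rewrite addrCA [q + _]addrC subrK.
Qed.

(** The conjugator is (x1, a x2 + h, a x3 + c). It serves to translate x3, to scale x2 and x3
    together, and to translate x2 by h(x3). The common factor [a] gives the action in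
    [scaling_orbit]. *)
Lemma conjugate_subst p f a c h : a != 0 ->
  BA3_conjugate
    (strictly_triangular
       (subst_x2x3 (a *: 'X + c%:P) (a%:P *: 'X + h%:P) p)
       (a^-1 *: (f \Po (a *: 'X + c%:P))) 0)
    (strictly_triangular p f 0).
Proof.
move=> a0; apply: (conjugate_intertwine (p := 0) (f := h) (c := c)
  (oner_neq0 _) a0 a0).
rewrite !pcomp_triangular !(mulr1, mul1r, scale1r, addr0, add0r).
rewrite rmorph0 addr0 comp_polyXr scalerA divff // scale1r.
by congr triangular; [rewrite addrC | rewrite mulr0 add0r].
Qed.

End Maps.

(** * Top coefficients under a shift of the variable *)

Section Translations.
Variable R : idomainType.
Implicit Types (p q r : {poly R}) (c w : R) (n : nat).

Lemma size_comp_XaddC p c : size (p \Po ('X + c%:P)) = size p.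
Proof. exact/size_comp_poly2/size_XaddC. Qed.

(** The size bound cuts the binomial expansion after two terms. It is applied with [R] equal to k
    and to k[x3]. *)
Lemma coef_comp_XaddC p c n : (size p <= n.+2)%N ->
  (p \Po ('X + c%:P))`_n = p`_n + c * p`_n.+1 *+ n.+1.
Proof.
elim/poly_ind: p n => [|p a IHp] n.
  by rewrite comp_poly0 !coef0 mulr0 mul0rn addr0.
move=> sz; have szp : (size p <= n.+1)%N.
  apply/leq_sizeP => j lt_nj; have /leq_sizeP/(_ j.+1) := sz.
  by rewrite coefD coefMX coefC addr0; apply.
rewrite comp_poly_MXaddC mulrDr !coefD !coefMX !coefMC !coefC /= addr0.
have -> : (p \Po ('X + c%:P))`_n = p`_n.
  by rewrite IHp 1?leqW // (leq_sizeP _ _ szp n.+1) // mulr0 mul0rn addr0.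
case: n {sz} szp => [|n] szp; first by rewrite !add0r mulr1n mulrC addrC.
by rewrite IHp // !addr0 [in RHS]mulrSr addrA [_ * c]mulrC.
Qed.

Lemma comp_poly_subD p q r :
  (p + q \Po r) - (p + q) = ((p \Po r) - p) + ((q \Po r) - q).
Proof. by rewrite comp_polyD opprD addrACA. Qed.

Lemma comp_XaddC_diff_monomial c w n :
  let d := (w *: 'X^(n.+1) \Po ('X + c%:P)) - w *: 'X^(n.+1) in
  (size d <= n.+1)%N /\ d`_n = c * w *+ n.+1.
Proof.
have szw : (size (w *: 'X^(n.+1)) <= n.+2)%N.
  by rewrite (leq_trans (size_scale_leq _ _)) // size_polyXn.
split=> /=; last first.
  rewrite coefB coef_comp_XaddC // !coefZ !coefXn eqxx mulr1 addrC addKr.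
  by [].
apply/leq_sizeP => j ltnj; rewrite coefB coef_comp_XaddC; last first.
  by rewrite (leq_trans szw) // ltnS ltnW.
rewrite [X in c * X](leq_sizeP _ _ szw) ?ltnS // mulr0 mul0rn addr0.
exact: subrr.
Qed.

Lemma size_sub_same_coef p q n : (size p <= n.+1)%N -> (size q <= n.+1)%N ->
  p`_n = q`_n -> (size (p - q)%R <= n)%N.
Proof.
move=> szp szq pq; apply/leq_sizeP => j; rewrite leq_eqVlt coefB.
case/predU1P=> [<-|ltnj]; first by rewrite pq subrr.
by rewrite (leq_sizeP _ _ szp) ?(leq_sizeP _ _ szq) ?subrr.
Qed.

End Translations.

(** * Reduction modulo ideals and by conjugation *)

Section Reduction.
Variable k : fieldType.
Implicit Types (a b c lam : k) (f g h u v : {poly k}) (p q r : {poly {poly k}}).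

Lemma coef_comp_scaleX f lam i : (f \Po (lam *: 'X))`_i = f`_i * lam ^+ i.
Proof.
elim/poly_ind: f i => [|f c IHf] i; first by rewrite comp_poly0 coef0 mul0r.
rewrite comp_poly_MXaddC -scalerAr !coefD coefZ !coefMX !coefC.
case: i => [|i] /=; first by rewrite mulr0 !add0r mulr1.
by rewrite !addr0 IHf exprS mulrCA.
Qed.

Lemma size_comp_scaleX f lam : lam != 0 -> size (f \Po (lam *: 'X)) = size f.
Proof. by move=> lam0; rewrite size_comp_poly2 // size_scale // size_polyX. Qed.

Lemma lowest_degree0 (I : {poly k} -> Prop) : lowest_degree_in_coset I 0.
Proof. by move=> b _; rewrite size_poly0. Qed.

Lemma ideal2_dvd g h f : ideal2 g h f -> gcdp g h %| f.
Proof.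
by move=> [u [v ->]]; rewrite dvdp_add // dvdp_mull ?dvdp_gcdl ?dvdp_gcdr.
Qed.

(** The ideal is generated by the gcd [d], so the remainder modulo [d] has lowest degree. *)
Lemma lowest_degree_exists g h f :
  exists u v, lowest_degree_in_coset (ideal2 g h) (f + u * g + v * h).
Proof.
pose d := gcdp g h.
have [u [v duv]] : exists u v, d = u * g + v * h.
  (* Bezout holds up to nonzero constants, absorbed in [c2^-1 * c1]. *)
  have [[u v] /eqpP [[c1 c2] /andP [/= c10 c20] e]] := Bezoutp g h.
  exists (c2^-1 * c1 *: u), (c2^-1 * c1 *: v).
  by rewrite -!scalerAl -scalerDr -scalerA e scalerA mulVf // scale1r.
exists (- (f %/ d) * u), (- (f %/ d) * v).
have -> : f + - (f %/ d) * u * g + - (f %/ d) * v * h = f %% d.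
  rewrite -addrA -!mulrA -mulrDr -duv mulNr {1}(divp_eq f d) addrAC subrr.
  by rewrite add0r.
move=> b /ideal2_dvd; rewrite -/d => dvd_d.
have [d0|d0] := eqVneq d 0.
  by move: dvd_d; rewrite d0 dvd0p subr_eq0 => /eqP <-.
rewrite leqNgt; apply/negP => ltb.
(* A smaller [b] would make [b - f %% d] a nonzero multiple of [d] with the size of the remainder,
   which is below that of [d]. *)
have := dvdp_leq _ dvd_d; rewrite subr_eq0.
case: eqP ltb => [<-|_ ltb /(_ isT)]; first by rewrite ltnn.
rewrite -opprB size_polyN size_polyDl ?size_polyN //.
by rewrite leqNgt ltn_modp d0.
Qed.

(** Scaling x3 preserves sizes and carries the ideal (f, h) into (s f, s h). *)
Lemma lowest_degree_scale lam f h u : lam != 0 ->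
  let s := comp_poly (lam *: 'X) in
  lowest_degree_in_coset (ideal2 (s f) (s h)) (s u) ->
  lowest_degree_in_coset (ideal2 f h) u.
Proof.
move=> lam0 s low b [v [w e]].
rewrite -(size_comp_scaleX u lam0) -(size_comp_scaleX b lam0); apply: low.
by exists (s v), (s w); rewrite /s -comp_polyB e comp_polyD !comp_polyM.
Qed.

Hypothesis char0 : [pchar k] =i pred0.

(** Characteristic zero enters through this fact: the reductions divide by n + 1. *)
Lemma natS_neq0 n : n.+1%:R != 0 :> k.
Proof. by rewrite ((pcharf0P k).1 char0). Qed.

Lemma translation_diff_surj c f :
  c != 0 -> exists g, (g \Po ('X + c%:P)) - g = f.
Proof.
move=> c0; move: {2}(size f) (leqnn (size f)) => n.
elim: n f => [|n IHn] f szf.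
  exists 0; rewrite comp_poly0 subr0; apply/esym/eqP.
  by rewrite -size_poly_leq0.
(* Solves c w (n + 1) = f_n, so the difference of w x3^(n+1) cancels the top coefficient. *)
pose w := f`_n / (c * n.+1%:R).
have [sz cf] := comp_XaddC_diff_monomial c w n.
have [|g gE] := IHn (f - ((w *: 'X^(n.+1) \Po ('X + c%:P)) - w *: 'X^(n.+1))).
  apply: size_sub_same_coef => //; rewrite cf -mulr_natr mulrAC mulrC divfK //.
  by rewrite mulf_neq0 ?natS_neq0.
exists (g + w *: 'X^(n.+1)).
by rewrite comp_poly_subD gE subrK.
Qed.

(** Induction on the size in x2: shifting x2 alters only lower degrees, so the top degree asks for
    u(x3 + c) - u, solved by the previous lemma. *)
Lemma subst_diff_surj c f p : c != 0 ->
  exists q, subst_x2x3 ('X + c%:P) ('X + f%:P) q - q = p.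
Proof.
move=> c0; move: {2}(size p) (leqnn (size p)) => n.
elim: n p => [|n IHn] p szp.
  exists 0; rewrite rmorph0 subr0; apply/esym/eqP.
  by rewrite -size_poly_leq0.
have [u uE] := translation_diff_surj p`_n c0.
pose m : {poly {poly k}} := u *: 'X^n.
pose m' : {poly {poly k}} := (u \Po ('X + c%:P)) *: 'X^n.
have szm (w : {poly k}) : (size (w *: 'X^n : {poly {poly k}}) <= n.+1)%N.
  by rewrite (leq_trans (size_scale_leq _ _)) // size_polyXn.
have mE : subst_x2x3 ('X + c%:P) ('X + f%:P) m = m' \Po ('X + f%:P).
  by rewrite /subst_x2x3 map_polyZ map_polyXn.
have [|q qE] := IHn (p - (subst_x2x3 ('X + c%:P) ('X + f%:P) m - m)).
  apply: size_sub_same_coef => //; rewrite mE.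
    rewrite (leq_trans (size_polyD _ _)) // size_polyN size_comp_XaddC.
    by rewrite geq_max !szm.
  rewrite coefB coef_comp_XaddC 1?leqW ?szm // /m /m' !coefZ !coefXn eqxx.
  by rewrite !mulr1 gtn_eqF // !mulr0 mul0rn addr0 uE.
by exists (q + m); rewrite rmorphD /= opprD addrACA qE subrK.
Qed.

Lemma coboundary_monomial f u n :
  exists q, let d := (q \Po ('X + f%:P)) - q in
  (size d <= n.+1)%N /\ d`_n = u * f.
Proof.
exists ((n.+1%:R^-1 *: u) *: 'X^(n.+1)).
have [sz cf] := comp_XaddC_diff_monomial f (n.+1%:R^-1 *: u) n.
split=> //; rewrite cf -scalerAr -scaler_nat scalerA divff ?natS_neq0 //.
by rewrite scale1r mulrC.
Qed.

(** One coboundary reduces the top coefficient, which is split off as [t]; the size bound in the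
    conclusion keeps later corrections away from it. *)
Lemma coboundary_reduction f p n : (size p <= n)%N ->
  exists q, let r := p + ((q \Po ('X + f%:P)) - q) in
  (size r <= n)%N /\ forall i, lowest_degree_in_coset (ideal2 f 0) r`_i.
Proof.
elim: n p => [|n IHn] p szp.
  exists 0; rewrite comp_poly0 subrr addr0; split=> // i.
  move: szp; rewrite size_poly_leq0 => /eqP ->; rewrite coef0.
  exact: lowest_degree0.
have [u [v low]] := lowest_degree_exists f 0 p`_n.
have [q0 [szd cd]] := coboundary_monomial f u n.
set d := _ - _ in szd cd.
pose t : {poly {poly k}} := (p + d)`_n *: 'X^n.
have szpd : (size (p + d)%R <= n.+1)%N.
  by rewrite (leq_trans (size_polyD _ _)) // geq_max szp.
have szt : (size t <= n.+1)%N.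
  by rewrite (leq_trans (size_scale_leq _ _)) // size_polyXn.
have ct : (p + d)`_n = t`_n by rewrite coefZ coefXn eqxx mulr1.
have [q [szr lowr]] := IHn _ (size_sub_same_coef szpd szt ct).
exists (q0 + q).
set r' := _ + _ in szr lowr.
have -> : p + ((q0 + q \Po ('X + f%:P)) - (q0 + q)) = r' + t.
  by rewrite comp_poly_subD -/d addrA /r' [in RHS]addrAC subrK.
split=> [|i].
  by rewrite (leq_trans (size_polyD _ _)) // geq_max szt leqW.
rewrite coefD [t`_i]coefZ coefXn; case: eqP => [->|_]; last first.
  by rewrite mulr0 addr0.
rewrite (leq_sizeP _ _ szr) // add0r mulr1 coefD cd.
by move: low; rewrite mulr0 addr0.
Qed.

(** Reducing modulo [f] first settles a_n, hence the ideal (f, a_n). Treating a_{n-1} then disturbs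
    the lower coefficients, which are reduced again. Here n = m + 1. *)
Lemma conjugate_reduced f p :
  exists2 r, BA3_conjugate (strictly_triangular p f 0)
                           (strictly_triangular r f 0)
           & reduced_coefficients f r.
Proof.
have [q0 []] := coboundary_reduction f (leqnn (size p)).
set r0 := p + _ => _ low0.
have c0 : BA3_conjugate (strictly_triangular p f 0)
                        (strictly_triangular r0 f 0).
  exact: conjugate_add_coboundary.
(* For n = 0 there is no a_{n-1} to treat. *)
case En: (size r0).-1 => [|m].
  by exists r0 => //; split=> [i _ _|]; [exact: low0 | rewrite En].
have sz0 : size r0 = m.+2 by move: En; case: (size r0) => //= n ->.
have [u [v low]] := lowest_degree_exists f r0`_m.+1 r0`_m.
(* Translating x2 by [h] adds (m + 1) h a_{m+1} = v a_{m+1} to a_m and fixes a_{m+1}. *)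
pose h := m.+1%:R^-1 *: v.
pose r1 := r0 \Po ('X + h%:P).
have c1 : BA3_conjugate (strictly_triangular r0 f 0)
                        (strictly_triangular r1 f 0).
  apply: BA3_conjugate_sym.
  have := conjugate_subst r0 f 0 h (oner_neq0 k).
  rewrite invr1 !scale1r addr0 comp_polyXr /subst_x2x3.
  by rewrite map_poly_id => // g _; rewrite comp_polyXr.
have r1m1 : r1`_m.+1 = r0`_m.+1.
  rewrite coef_comp_XaddC ?sz0 // [r0`_m.+2]nth_default ?sz0 //.
  by rewrite mulr0 mul0rn addr0.
have r1m : r1`_m = r0`_m + v * r0`_m.+1.
  rewrite coef_comp_XaddC ?sz0 // -scalerAl -scaler_nat scalerA.
  by rewrite divff ?natS_neq0 // scale1r.
have [q1 [szd cd]] := coboundary_monomial f u m.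
set d := _ - _ in szd cd.
pose r2 := r1 + d.
(* The two top terms are final; setting them aside leaves size at most m for the last reduction. *)
pose t : {poly {poly k}} := r2`_m.+1 *: 'X^(m.+1) + r2`_m *: 'X^m.
have tE j : t`_j = r2`_m.+1 *+ (j == m.+1) + r2`_m *+ (j == m).
  by rewrite coefD !coefZ !coefXn !mulr_natr.
have sz2 : (size (r2 - t)%R <= m)%N.
  apply/leq_sizeP => j lemj; rewrite coefB tE.
  have [->|nm1] := eqVneq j m.+1; first by rewrite gtn_eqF // addr0 subrr.
  have [->|nm] := eqVneq j m; first by rewrite add0r subrr.
  have lt : (m.+1 < j)%N by rewrite ltn_neqAle eq_sym nm1 ltn_neqAle eq_sym nm.
  rewrite addr0 subr0 coefD !nth_default ?addr0 ?size_comp_XaddC ?sz0 //.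
  by rewrite (leq_trans szd) // ltnW.
have [q2 [sz3 low3]] := coboundary_reduction f sz2.
set r3 := _ + _ in sz3 low3.
pose r := r2 + ((q2 \Po ('X + f%:P)) - q2).
have rE j : r`_j = r3`_j + t`_j by rewrite -coefD /r3 /r [in RHS]addrAC subrK.
have rm1 : r`_m.+1 = r0`_m.+1.
  rewrite rE tE nth_default 1?leqW // eqxx gtn_eqF // addr0 add0r coefD r1m1.
  by rewrite [d`__]nth_default // addr0.
have rm : r`_m = r0`_m + u * f + v * r0`_m.+1.
  rewrite rE tE nth_default // eqxx ltn_eqF // !add0r coefD r1m cd.
  by rewrite addrAC.
have rlt i : (i < m)%N -> r`_i = r3`_i.
  by move=> ltim; rewrite rE tE !ltn_eqF // ?addr0 // ltnW.
(* [reduced_coefficients] reads n off the size, so the top coefficient must be seen to survive. *)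
have szr : size r = m.+2.
  apply/eqP; rewrite eqn_leq; apply/andP; split.
    apply/leq_sizeP => j ltj; rewrite rE tE.
    rewrite !gtn_eqF ?addr0 //; last exact: ltnW.
    by rewrite nth_default // (leq_trans sz3) // ltnW // ltnW.
  rewrite ltnNge; apply/negP => /leq_sizeP/(_ _ (leqnn _)).
  rewrite rm1 => e0; have := lead_coef_eq0 r0.
  by rewrite lead_coefE sz0 e0 eqxx -size_poly_eq0 sz0.
exists r.
  apply: BA3_conjugate_trans c0 _; apply: BA3_conjugate_trans c1 _.
  apply: BA3_conjugate_trans (conjugate_add_coboundary _ _ q1) _.
  exact: conjugate_add_coboundary.
rewrite /reduced_coefficients szr /=; split=> [i|_]; last by rewrite rm rm1.
rewrite leq_eqVlt => /predU1P [->|]; first by rewrite rm1.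
rewrite ltnS leq_eqVlt => /predU1P [->|ltim _]; first by [].
by rewrite rlt.
Qed.

Lemma conjugate_next_to_highest_zero p f :
  exists p' f', BA3_conjugate (strictly_triangular p f 0)
                              (strictly_triangular p' f' 0)
             /\ next_to_highest_zero f'.
Proof.
case sz: (size f) => [|[|m]].
- exists p, f; split; last by rewrite /next_to_highest_zero sz.
  (* Reflexivity, from the zero coboundary. *)
  by have := conjugate_add_coboundary p f 0; rewrite comp_poly0 subrr addr0.
- exists p, f; split; last by rewrite /next_to_highest_zero sz.
  by have := conjugate_add_coboundary p f 0; rewrite comp_poly0 subrr addr0.
(* Chosen so that f_m + (m + 1) c f_{m+1}, the new next-to-highest coefficient, vanishes. *)
pose c := - f`_m / (f`_m.+1 * m.+1%:R).
exists (subst_x2x3 (1 *: 'X + c%:P) (1%:P *: 'X + 0%:P) p), (f \Po ('X + c%:P)).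
split.
  apply: BA3_conjugate_sym.
  have := conjugate_subst p f c 0 (oner_neq0 k).
  by rewrite invr1 !scale1r.
rewrite /next_to_highest_zero size_comp_XaddC sz /= => _.
have lc0 : f`_m.+1 != 0.
  have := lead_coef_eq0 f; rewrite lead_coefE sz /= => ->.
  by rewrite -size_poly_eq0 sz.
rewrite coef_comp_XaddC ?sz // -mulr_natr -mulrA divfK ?subrr //.
by rewrite mulf_neq0 ?natS_neq0.
Qed.

End Reduction.

(** * Scaling orbits and assembly of the normal form *)

Section NormalForms.
Variable k : fieldType.
Implicit Types (f : {poly k}) (p : {poly {poly k}}).

Lemma strictly_triangularE p f :
  [tuple x1 k + in_x2x3 p; x2 k + in_x3 f; x3 k] = strictly_triangular p f 0.
Proof.
by apply: polymapP; rewrite !tnth_triangular ?scale1r ?addr0.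
Qed.

(** Components of the intertwining equation are compared: the second shows that only scalings fixing
    [f] occur, the first relates [p] to [q]. *)
Lemma sequence_orbitE f p q : sequence_orbit f p q ->
  exists lam, [/\ lam != 0,
    BA3_conjugate (strictly_triangular p f 0) (strictly_triangular q f 0),
    f \Po (lam *: 'X) = f & p = map_poly (comp_poly (lam *: 'X)) q].
Proof.
move=> [lam lam0 conj]; exists lam.
have [K [_ KH] E] := conj.
have : triangular 1 1 lam p f 0 = triangular 1 1 lam
         (map_poly (comp_poly (lam *: 'X)) q) (f \Po (lam *: 'X)) 0.
  have : Defs.pcomp (strictly_triangular q f 0) (triangular 1 1 lam 0 0 0) =
         Defs.pcomp (triangular 1 1 lam 0 0 0) (strictly_triangular p f 0).
    by rewrite E -pcompA KH pcompr1.
  rewrite !pcomp_triangular !(mulr1, mul1r, scale1r, addr0, add0r).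
  by rewrite rmorph0 comp_poly0 !addr0 /subst_x2x3 mulr0 comp_polyXr => <-.
move=> eqT; split=> //.
- by exists (triangular 1 1 lam 0 0 0) => //;
    exists 1, 1, lam, 0, 0, 0; split; rewrite ?oner_neq0.
- apply: in_x3_inj; move: (congr1 (fun F => tnth F (@Ordinal 3 1 isT)) eqT).
  by rewrite !tnth_triangular => /addrI.
- apply: in_x2x3_inj; move: (congr1 (fun F => tnth F (@Ordinal 3 0 isT)) eqT).
  by rewrite !tnth_triangular => /addrI.
Qed.

(** As the scaling fixes [f] and the degree in x2, it matches the ideals for [q] with those for
    [p]. *)
Lemma reduced_sequence_orbit f p q :
  sequence_orbit f p q -> reduced_coefficients f p -> reduced_coefficients f q.
Proof.
move=> /sequence_orbitE [lam [lam0 _ fE ->]].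
have sz : size (map_poly (comp_poly (lam *: 'X)) q) = size q.
  apply: size_map_inj_poly; last exact: comp_poly0.
  move=> g h /eqP; rewrite -subr_eq0 -comp_polyB comp_poly2_eq0.
    by rewrite subr_eq0 => /eqP.
  by rewrite size_scale // size_polyX.
rewrite /reduced_coefficients sz => -[low low1]; split=> [i lei nei|n0].
  apply: (lowest_degree_scale lam0); rewrite fE comp_poly0.
  by have := low i lei nei; rewrite coef_map.
apply: (lowest_degree_scale lam0); rewrite fE.
by have := low1 n0; rewrite !coef_map.
Qed.

Lemma scaling_orbit_next_to_highest_zero f g :
  scaling_orbit f g -> next_to_highest_zero f -> next_to_highest_zero g.
Proof.
move=> [lam lam0 ->]; rewrite /next_to_highest_zero.
rewrite size_scale ?invr_neq0 // size_comp_scaleX // => fz /fz.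
by rewrite coefZ coef_comp_scaleX => ->; rewrite mul0r mulr0.
Qed.

Lemma scaling_orbit_conjugate p f g : scaling_orbit f g ->
  exists p', BA3_conjugate (strictly_triangular p f 0)
                           (strictly_triangular p' g 0).
Proof.
move=> [lam lam0 ->]; eexists; apply: BA3_conjugate_sym.
by have := conjugate_subst p f 0 0 lam0; rewrite polyC0 addr0; apply.
Qed.

Variables (P2 : {poly k} -> Prop) (P1 : {poly k} -> {poly {poly k}} -> Prop).

Lemma normal_form_BAs3 F : normal_form P2 P1 F -> BAs3 F.
Proof.
case=> [->|->|[p [f [-> _ _ _ _]]]].
- by exists 0, 0, 0; apply: polymapP;
    rewrite tnth_triangular ?rmorph0 ?addr0 ?scale1r.
- by exists 0, 0, 1; apply: polymapP;
    rewrite tnth_triangular ?rmorph0 ?addr0 ?scale1r.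
- by exists p, f, 0; rewrite strictly_triangularE.
Qed.

(** The second component is settled first, since moving it changes the first one; the later
    conjugations keep it. *)
Lemma normal_form_exists F : [pchar k] =i pred0 ->
  representatives (@scaling_orbit k) P2 ->
  (forall f, representatives (sequence_orbit f) (P1 f)) ->
  BAs3 F -> exists2 N, normal_form P2 P1 N & BA3_conjugate F N.
Proof.
move=> char0 hP2 hP1 [p [f [c ->]]].
have [->|c0] := eqVneq c 0; last first.
  exists (strictly_triangular 0 0 1).
    by apply: Or32; apply: polymapP;
      rewrite tnth_triangular ?rmorph0 ?addr0 ?scale1r.
  (* The signs account for the conjugation using g - g(x3 + c) instead of its opposite. *)
  have [g gE] := translation_diff_surj char0 (- f) c0.
  have [q qE] := subst_diff_surj char0 f (- p) c0.
  apply: (conjugate_translation (q := q) (g := g)) => //.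
    by rewrite -opprB qE opprK.
  by rewrite -opprB gE opprK.
have [p1 [f1 [conj1 f1z]]] := conjugate_next_to_highest_zero char0 p f.
have [f2 [[of2 P2f2] _]] := hP2 f1.
have [p2 conj2] := scaling_orbit_conjugate p1 of2.
have [p3 conj3 red3] := conjugate_reduced char0 f2 p2.
have [p4 [[op4 P1p4] _]] := hP1 f2 p3.
have [lam [_ conj4 _ _]] := sequence_orbitE op4.
exists (strictly_triangular p4 f2 0).
  apply: Or33; exists p4, f2; split=> //.
  - by rewrite strictly_triangularE.
  - exact: scaling_orbit_next_to_highest_zero of2 f1z.
  - exact: reduced_sequence_orbit op4 red3.
apply: BA3_conjugate_trans conj1 _; apply: BA3_conjugate_trans conj2 _.
exact: BA3_conjugate_trans conj3 conj4.
Qed.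

End NormalForms.

Theorem theorem2p14 (k : fieldType) (char0 : [pchar k] =i pred0)
    (P2 : {poly k} -> Prop) (P1 : {poly k} -> {poly {poly k}} -> Prop)
    (hP2 : representatives (@scaling_orbit k) P2)
    (hP1 : forall f2 : {poly k}, representatives (sequence_orbit f2) (P1 f2))
    (C : polymap k -> Prop) :
  is_conj_class C <->
  exists2 F, normal_form P2 P1 F & forall G, C G <-> conj_class F G.
Proof.
(* Conversely, normal forms are strictly triangular, so each defines a class. *)
split=> [[F BF CF]|[F NF CF]]; last first.
  by exists F => //; apply: normal_form_BAs3 NF.
have [N NN FN] := normal_form_exists char0 hP2 hP1 BF.
exists N => // G; apply: (iff_trans (CF G)).
exact: BA3_conjugate_conj_class.
Qed.
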